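(* Let $m\le n$, let $Y\in\mathbb{R}^{m\times n}$ have singular values $\sigma_{Y,1}\ge\cdots\ge\sigma_{Y,m}\ge0$, and let $\mathbf{w}=(w_1,\ldots,w_m)$ be weights with $0<w_1\le w_2\le\cdots\le w_m$. Let $\widehat{X}_{\mathbf{w}}(\lambda)=\operatorname{WSVT}_\lambda(Y)$ be the solution of $\min_{X\in\mathbb{R}^{m\times n}}\|X\|_{\mathbf{w},*}+\frac{1}{2\lambda}\|Y-X\|_F^2$ obtained by applying the weighted singular value thresholding operator to $Y$. Then the function $\psi(\lambda)=\|Y-\widehat{X}_{\mathbf{w}}(\lambda)\|_F^2$ is a positive and strictly increasing function of $\lambda$ in the interval $[0,\sigma_{Y,1}]$.
   Context: $\|\cdot\|_F$ is the Frobenius norm. For $X\in\mathbb{R}^{m\times n}$ with singular values $\sigma_{X,1}\ge\cdots\ge\sigma_{X,m}\ge0$, the weighted nuclear norm is $\|X\|_{\mathbf{w},*}=\sum_{i=1}^m w_i\sigma_{X,i}$. Write a singular value decomposition $Y=\sum_{i=1}^m\sigma_{Y,i}\mathbf{u}_i\mathbf{v}_i^T$ with orthonormal left singular vectors $\mathbf{u}_i\in\mathbb{R}^m$ and orthonormal right singular vectors $\mathbf{v}_i\in\mathbb{R}^n$. With $(x)_+=\max(x,0)$, the weighted singular value thresholding operator is $\operatorname{WSVT}_\lambda(Y)=\sum_{i=1}^m(\sigma_{Y,i}-\lambda w_i)_+\mathbf{u}_i\mathbf{v}_i^T$; for $\lambda>0$ it gives a global solution of the minimization problem in the claim, and at $\lambda=0$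 the matrix $\widehat{X}_{\mathbf{w}}(0)$ is understood through this formula.
   Formalization: Since ψ(0)=0, ψ is shown ≥0 on [0,σ_{Y,1}] and >0 on (0,σ_{Y,1}]; since ψ is constant beyond σ_{Y,1}/w_1, strict increase is shown on [0,σ_{Y,1}/w_1] for all weights and on [0,σ_{Y,1}] only when w_1≤1. *)

(* Defs.v *)
From HB Require Import structures.
From mathcomp Require Import all_boot all_order all_algebra.
From mathcomp Require Import reals.

Set Implicit Arguments.
Unset Strict Implicit.
Unset Printing Implicit Defensive.

Import Order.TTheory GRing.Theory Num.Theory.
Local Open Scope ring_scope.

Section WeightedThresholding.
Variable R : realType.

Definition frobenius_norm m n (A : 'M[R]_(m, n)) : R :=
  Num.sqrt (\sum_(i < m) \sum_(j < n) A i j ^+ 2).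

(* Thin singular value decomposition: the columns of U and V are the left and
   right singular vectors. Orthonormality of the m columns of V forces m <= n. *)
Definition is_svd m n (Y : 'M[R]_(m, n))
    (s : 'rV[R]_m) (U : 'M[R]_m) (V : 'M[R]_(n, m)) : Prop :=
  [/\ U^T *m U = 1%:M,
      V^T *m V = 1%:M,
      forall i, 0 <= s 0 i,
      forall i j : 'I_m, (i <= j)%N -> s 0 j <= s 0 i
    & Y = \sum_(i < m) s 0 i *: (col i U *m (col i V)^T)].

(* The decomposition is an argument because, when Y has repeated singular
   values and the weights differ, the resulting matrix depends on its choice. *)
Definition wsvt m n (w s : 'rV[R]_m) (U : 'M[R]_m) (V : 'M[R]_(n, m))
    (lambda : R) : 'M[R]_(m, n) :=
  \sum_(i < m)
    Num.max (s 0 i - lambda * w 0 i) 0 *: (col i U *m (col i V)^T).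

(* For lambda >= 0 this equals \sum_i (min (s_i, lambda * w_i))^2. It therefore
   vanishes at 0, and for nondecreasing positive weights it is constant from
   lambda = s_1 / w_1 on, a threshold that lies below s_1 when w_1 > 1 and
   s_1 > 0. *)
Definition psi m n (Y : 'M[R]_(m, n)) (w s : 'rV[R]_m) (U : 'M[R]_m)
    (V : 'M[R]_(n, m)) (lambda : R) : R :=
  frobenius_norm (Y - wsvt w s U V lambda) ^+ 2.

End WeightedThresholding.

(* Main.v *)
Require Import Defs.
From mathcomp Require Import all_boot all_order all_algebra.
From mathcomp Require Import reals.

Import Order.TTheory GRing.Theory Num.Theory.
Local Open Scope ring_scope.

(** In the orthonormal systems [u_i], [v_i] the residual [Y - WSVT_lambda(Y)]
    is diagonal with entries [min(s_i, lambda w_i)], so [psi lambda] is the sum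
    of their squares. Every term is nondecreasing for [lambda >= 0], and the
    term of index [0] is strictly increasing up to [s_0 / w_0]. *)

Lemma frobenius_norm_sqr (R : realType) (m n : nat) (A : 'M[R]_(m, n)) :
  frobenius_norm A ^+ 2 = \tr (A *m A^T).
Proof.
rewrite sqr_sqrtr; last first.
  by apply: sumr_ge0 => i _; apply: sumr_ge0 => j _; exact: sqr_ge0.
by apply: eq_bigr => i _; rewrite mxE; apply: eq_bigr => j _; rewrite mxE expr2.
Qed.

(** The product form lets orthonormality act by cancelling [U^T *m U] and [V^T *m V]. *)
Lemma sum_outer_diag_mx (R : comPzRingType) (m n p : nat) (d : 'rV[R]_p)
    (U : 'M[R]_(m, p)) (V : 'M[R]_(n, p)) :
  \sum_(i < p) d 0 i *: (col i U *m (col i V)^T) = U *m diag_mx d *m V^T.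
Proof.
apply/matrixP => a b; rewrite summxE mul_mx_diag mxE; apply: eq_bigr => i _.
by rewrite !mxE big_ord1 !mxE mulrA (mulrC (d 0 i)).
Qed.

Lemma frobenius_norm_sqr_outer (R : realType) (m n p : nat) (d : 'rV[R]_p)
    (U : 'M[R]_(m, p)) (V : 'M[R]_(n, p)) :
    U^T *m U = 1%:M -> V^T *m V = 1%:M ->
  frobenius_norm (\sum_(i < p) d 0 i *: (col i U *m (col i V)^T)) ^+ 2 =
  \sum_(i < p) d 0 i ^+ 2.
Proof.
move=> UU VV; rewrite frobenius_norm_sqr sum_outer_diag_mx.
rewrite !trmx_mul trmxK tr_diag_mx -!mulmxA (mulmxA V^T) VV mul1mx.
(* [V] has cancelled inside the product; cyclicity of the trace now brings [U^T] next to [U]. *)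
rewrite mxtrace_mulC -!mulmxA UU mulmx1 mulmx_diag mxtrace_diag.
by apply: eq_bigr => i _; rewrite mxE expr2.
Qed.

Lemma psiE (R : realType) (m n : nat) (Y : 'M[R]_(m, n)) (w s : 'rV[R]_m)
    (U : 'M[R]_m) (V : 'M[R]_(n, m)) (lambda : R) : is_svd Y s U V ->
  psi Y w s U V lambda = \sum_(i < m) Num.min (s 0 i) (lambda * w 0 i) ^+ 2.
Proof.
case=> UU VV _ _ ->; rewrite /psi /wsvt -sumrB.
under eq_bigr => i _.
  have -> : s 0 i *: (col i U *m (col i V)^T)
      - Num.max (s 0 i - lambda * w 0 i) 0 *: (col i U *m (col i V)^T)
    = (\row_j Num.min (s 0 j) (lambda * w 0 j)) 0 i *: (col i U *m (col i V)^T).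
    rewrite -scalerBl mxE; congr (_ *: _).
    (* With t = lambda w_i: s - max(s - t, 0) = s + min(t - s, 0) = min(t, s). *)
    by rewrite oppr_max addr_minr opprB oppr0 addr0 addrCA subrr addr0 minC.
  over.
by rewrite frobenius_norm_sqr_outer //; apply: eq_bigr => i _; rewrite mxE.
Qed.

Arguments psiE {R m n Y w s U V lambda}.

Section Monotonicity.
Variables (R : realDomainType) (x y a b : R).
Hypotheses (y_gt0 : 0 < y) (a_ge0 : 0 <= a).

Lemma le_sqr_min : 0 <= x -> a <= b ->
  Num.min x (a * y) ^+ 2 <= Num.min x (b * y) ^+ 2.
Proof.
move=> x0 ab; have b0 : 0 <= b := le_trans a_ge0 ab.
rewrite ler_pXn2r ?nnegrE ?le_min ?x0 ?mulr_ge0 ?(ltW y_gt0) //.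
by rewrite !ge_min lexx /= ler_pM2r // ab orbT.
Qed.

(** Below the threshold x / y both minima lie on the linear branch, and squaring is strictly
    increasing on nonnegative numbers. *)
Lemma lt_sqr_min : a < b -> b * y <= x ->
  Num.min x (a * y) ^+ 2 < Num.min x (b * y) ^+ 2.
Proof.
move=> ab byx; have aby : a * y < b * y by rewrite ltr_pM2r.
rewrite !min_r //; last exact: le_trans (ltW aby) byx.
have ay0 : 0 <= a * y by rewrite mulr_ge0 // ltW.
by rewrite ltr_pXn2r ?nnegrE // ltW // (le_lt_trans ay0).
Qed.

End Monotonicity.

(** Strict positivity excludes 0, where [psi] vanishes. Strict growth ends at [s 0 ord0 / w 0 ord0],
    the largest of the ratios s_i / w_i, beyond which every term is saturated. *)
Theorem theorem4p3 (R : realType) (m n : nat) (hmn : (m.+1 <= n)%N)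
    (Y : 'M[R]_(m.+1, n))
    (s : 'rV[R]_m.+1) (U : 'M[R]_m.+1) (V : 'M[R]_(n, m.+1))
    (hY : is_svd Y s U V)
    (w : 'rV[R]_m.+1)
    (hw_pos : 0 < w 0 ord0)
    (hw_mono : forall i j : 'I_m.+1, (i <= j)%N -> w 0 i <= w 0 j) :
  [/\ {in `[0, s 0 ord0], forall lambda, 0 <= psi Y w s U V lambda},
      {in `]0, s 0 ord0], forall lambda, 0 < psi Y w s U V lambda},
      {in `[0, s 0 ord0 / w 0 ord0] &, {homo psi Y w s U V : a b / a < b}}
    & w 0 ord0 <= 1 ->
      {in `[0, s 0 ord0] &, {homo psi Y w s U V : a b / a < b}}].
Proof.
have s_ge0 : forall i, 0 <= s 0 i by case: hY.
have w_gt0 i : 0 < w 0 i by apply: lt_le_trans hw_pos _; exact: hw_mono.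
have incr : {in `[0, s 0 ord0 / w 0 ord0] &,
    {homo psi Y w s U V : a b / a < b}}.
  move=> a b; rewrite !in_itv /= => /andP[a0 _] /andP[_ bs] ab.
  (* Only the leading term is sure to grow strictly: the others may saturate earlier. *)
  rewrite !(psiE hY) !big_ord_recl ltr_leD //.
    by apply: lt_sqr_min; rewrite // -ler_pdivlMr.
  by apply: ler_sum => i _; apply: le_sqr_min => //; exact: ltW.
split=> // [lambda _|lambda|w1 a b].
- exact: sqr_ge0.
- rewrite in_itv /= => /andP[l0 ls].
  rewrite (psiE hY) big_ord_recl ltr_wpDr //.
    by apply: sumr_ge0 => i _; exact: sqr_ge0.
  (* The bounds 0 < lambda <= [s 0 ord0] themselves force [s 0 ord0] to be positive. *)
  by rewrite exprn_gt0 // lt_min (lt_le_trans l0 ls) mulr_gt0.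
(* Dividing by a weight at most 1 can only enlarge the interval. *)
- have sub x : x \in `[0, s 0 ord0] -> x \in `[0, s 0 ord0 / w 0 ord0].
    rewrite !in_itv /= => /andP[x0 xs]; rewrite x0 ler_pdivlMr //.
    by apply: le_trans xs; rewrite ler_piMr.
  by move=> /sub ? /sub ?; exact: incr.
Qed.
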